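(* Let $n\ge 2$. For every tower $(g_2,\dots,g_n)$, the total Coxeter length $\Lambda=\sum_{k=2}^{n}\ell(g_k)$ satisfies $\Lambda\le\binom{n+1}{3}$, with equality only for $g_k=w_{0,J_k}$ $(2\le k\le n)$; this sequence is a tower, namely Zaks' tower $(r_2,\dots,r_n)$, and it attains equality.
   Context: Permutations in $S_n$ are multiplied as functions: $(\pi g)(i)=\pi(g(i))$. For $1\le k\le n$, $G_k=\mathrm{Sym}\{1,\dots,k\}$ is the subgroup of $S_n$ of permutations fixing each of $k+1,\dots,n$. A $k$-cycle on $\{1,\dots,k\}$ is an element of $G_k$ that is a single cycle of length $k$. A tower is a sequence $(g_2,\dots,g_n)$ with $g_k\in G_k\setminus G_{k-1}$ such that, setting $g_1:=\mathbf 1$, each $u_k:=g_{k-1}^{-1}g_k$ is a $k$-cycle on $\{1,\dots,k\}$ $(2\le k\le n)$. $\ell$ denotes Coxeter length in $S_n=W(A_{n-1})$ with respect to the simple reflections $s_i=(i\ \,i{+}1)$, equal to the number of inversions. $J_k=\{s_1,\dots,s_{k-1}\}$, so the standard parabolic subgroup $W_{J_k}$ equals $G_k$, and $w_{0,J_k}$ is its longest element. $r_k\in S_n$ is the reversal of the first $k$ letters: $r_k(i)=k+1-i$ for $i\le k$, $r_k(i)=i$ for $i>k$. Zaks' tower is the tower $g_k=r_k$. *)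

(* Defs.v *)
From mathcomp Require Import all_boot all_fingroup.
From mathcomp Require Import zify.

Set Implicit Arguments.
Unset Strict Implicit.
Unset Printing Implicit Defensive.

(* The letters 1, ..., n are represented by 'I_n = {0, ..., n-1}.  MathComp
   composes permutations from left to right, (s * t) x = t (s x), so the
   product "a b" of permutations multiplied as functions is written b * a. *)

Definition first_letters (n k : nat) : {set 'I_n} := [set i : 'I_n | i < k].

Definition G (n k : nat) : {set 'S_n} := Sym (first_letters n k).

(* For k >= 2, a permutation supported on the first k letters and having these
   letters as one of its orbits is a single cycle of length k. *)
Definition is_full_cycle (n k : nat) (u : 'S_n) : Prop :=
  u \in G n k /\ first_letters n k \in porbits u.

(* The terms of a sequence outside the indices 2, ..., n are irrelevant. *)
Definition with_g1 (n : nat) (g : nat -> 'S_n) (k : nat) : 'S_n :=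
  if k <= 1 then 1%g else g k.

(* As functions, step g k is g_{k-1}^{-1} g_k. *)
Definition step (n : nat) (g : nat -> 'S_n) (k : nat) : 'S_n :=
  (with_g1 g k * (with_g1 g k.-1)^-1)%g.

Definition is_tower (n : nat) (g : nat -> 'S_n) : Prop :=
  forall k : nat, 2 <= k <= n ->
    [/\ g k \in G n k, g k \notin G n k.-1 & is_full_cycle k (step g k)].

(* The transpositions of two adjacent letters among the first k letters. *)
Definition J (n k : nat) : {set 'S_n} :=
  [set tperm i j | i in 'I_n,
                   j in [pred j : 'I_n | (j == i.+1 :> nat) && (j < k)]].

Definition simple_reflections (n : nat) : {set 'S_n} := J n n.

Lemma tperm_gen (n : nat) (i j : 'I_n) :
  i < j -> tperm i j \in <<simple_reflections n>>%g.
Proof.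
have [d le_jd] := ubnP (j : nat); elim: d => // d IHd in j le_jd * => lt_ij.
have adj (a b : 'I_n) : b = a.+1 :> nat ->
    tperm a b \in <<simple_reflections n>>%g.
  move=> eq_b; apply: mem_gen; apply/imset2P; exists a b => //.
  by rewrite inE eq_b eqxx -eq_b ltn_ord.
have [/adj // | neq_j] := eqVneq (j : nat) i.+1.
have lt_j'n : j.-1 < n by have := ltn_ord j; lia.
pose j' := Ordinal lt_j'n.
have -> : tperm i j = (tperm i j' ^ tperm j' j)%g.
  rewrite tpermJ tpermL tpermD //; apply/eqP => /(congr1 val) /=; lia.
rewrite groupJ //; last by apply: adj => /=; lia.
by apply: IHd => /=; lia.
Qed.

Lemma simple_reflections_gen (n : nat) (w : 'S_n) :
  w \in <<simple_reflections n>>%g.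
Proof.
have [ts -> ts_neq] := prod_tpermP w.
elim: ts ts_neq => [|[a b] ts IHts] /=; first by rewrite big_nil group1.
case/andP=> /= neq_ab /IHts in_ts; rewrite big_cons groupM //=.
have [lt_ab | lt_ba | eq_ab] := ltngtP a b; first exact: tperm_gen.
  by rewrite tpermC; exact: tperm_gen.
by move: neq_ab; rewrite /dpair /= (val_inj eq_ab) eqxx.
Qed.

Definition has_word (n : nat) (w : 'S_n) (m : nat) : bool :=
  [exists t : m.-tuple 'S_n,
     all (mem (simple_reflections n)) t && ((\prod_(s <- t) s)%g == w)].

Lemma has_word_ex (n : nat) (w : 'S_n) : exists m, has_word w m.
Proof.
have /gen_prodgP[m [c c_refl ->]] := simple_reflections_gen w.
exists m; apply/existsP; exists [tuple c i | i < m]; apply/andP; split.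
  by apply/allP=> s /mapP[i _ ->]; exact: c_refl.
by rewrite big_tuple; apply/eqP/eq_bigr => i _; rewrite tnth_mktuple.
Qed.

(* The least length of an expression of w as a product of simple reflections. *)
Definition coxeter_length (n : nat) (w : 'S_n) : nat := ex_minn (has_word_ex w).

(* The parabolic subgroup W_{J_k}. *)
Definition W (n k : nat) : {group 'S_n} := <<J n k>>%G.

(* An element of maximal length in W_{J_k}; such an element is unique. *)
Definition w0 (n k : nat) : 'S_n :=
  [arg max_(w > 1%g in W n k) coxeter_length w].

(* insubd falls back to i when the value k.-1 - i is not < n, which happens
   only if k > n. *)
Definition reversal_fun (n k : nat) (i : 'I_n) : 'I_n :=
  if i < k then insubd i (k.-1 - i) else i.

Lemma reversal_fun_inj (n k : nat) : injective (@reversal_fun n k).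
Proof.
have insubdE (a : 'I_n) m : insubd a m = (if m < n then m else a) :> nat.
  exact: val_insubd.
move=> i j /(congr1 (@nat_of_ord n)); rewrite /reversal_fun => eq_ij.
apply: ord_inj; have lt_in := ltn_ord i; have lt_jn := ltn_ord j.
move: eq_ij; case: ifP => ik; case: ifP => jk; rewrite ?insubdE;
  repeat case: ifP; move=> *; lia.
Qed.

Definition reversal (n k : nat) : 'S_n := perm (@reversal_fun_inj n k).

Definition total_length (n : nat) (g : nat -> 'S_n) : nat :=
  \sum_(2 <= k < n.+1) coxeter_length (g k).

(* Main.v *)
Require Import Defs.
From mathcomp Require Import all_boot all_fingroup.
From mathcomp Require Import zify.

Set Implicit Arguments.
Unset Strict Implicit.
Unset Printing Implicit Defensive.

(** The bound holds term by term.  Coxeter length is the number of inversions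
    ([coxeter_lengthE]), and an inversion of a permutation supported on the
    first k letters is a pair of such letters, so that the length of g_k is at
    most 'C(k, 2) ([leq_card_inversions]).  If equality holds for g_k, then
    every pair of the first k letters is an inversion, as it is for the
    reversal r_k; a permutation is determined by its inversions
    ([inversions_inj]), so g_k = r_k.  Summing over k with the hockey-stick
    identity gives the bound 'C(n + 1, 3) on the total length, and equality of
    the sums forces equality for each k.

    The same argument applied to W_{J_k}, which consists of permutations
    supported on the first k letters and contains r_k, shows that its longest
    element is r_k ([w0E]).  Finally, the reversals form a tower since the step
    r_{k-1} r_k (as functions) lowers each of the first k letters by one,
    cyclically ([step_reversal_cycle]).

    The length formula rests on one computation ([card_inversions_tperm]):
    precomposing with an adjacent transposition changes the number of
    inversions by exactly one.  Hence a word for w has at least as many letters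
    as w has inversions; and, as a permutation other than 1 has an adjacent
    descent, sorting w by such transpositions yields a word with exactly as
    many letters ([inversions_word]). *)

(** * Inversions *)

Definition inversions n (w : 'S_n) : {set 'I_n * 'I_n} :=
  [set p : 'I_n * 'I_n | (p.1 < p.2) && (w p.2 < w p.1)].

Definition first_pairs n k : {set 'I_n * 'I_n} :=
  [set p : 'I_n * 'I_n | (p.1 < p.2) && (p.2 < k)].

(** An increasing map of 'I_n to itself satisfies i <= w i for all i; the inverse
    of w is increasing too, whence w i <= i. *)
Lemma increasing_perm1 n (w : 'S_n) :
  {homo w : i j / i < j} -> w = 1%g.
Proof.
have le_incr (v : 'S_n) : {homo v : i j / i < j} -> forall i : 'I_n, i <= v i.
  move=> v_incr i; have [d] := ubnP (i : nat); elim: d => // d IHd in i *.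
  case: i => [[|m] lt_mn] //= lt_md.
  have := v_incr (Ordinal (ltnW lt_mn)) (Ordinal lt_mn) (ltnSn m).
  exact: leq_ltn_trans (IHd (Ordinal (ltnW lt_mn)) lt_md).
move=> w_incr; apply/permP => i; rewrite perm1; apply: ord_inj; apply/eqP.
rewrite eqn_leq le_incr // andbT.
have winv_incr : {homo (w^-1)%g : a b / a < b}.
  move=> a b lt_ab; rewrite ltnNge leq_eqVlt; apply/negP => /orP[/eqP|] h.
    by move: lt_ab; rewrite (perm_inj (ord_inj h)) ltnn.
  by have := w_incr _ _ h; rewrite !permKV ltnNge (ltnW lt_ab).
by have := le_incr _ winv_incr (w i); rewrite permK.
Qed.

Lemma ltn_perm_inversions n (w : 'S_n) (i j : 'I_n) :
  (w i < w j) = if i < j then (i, j) \notin inversions w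
                else (j, i) \in inversions w.
Proof.
rewrite !inE /=; case: (ltngtP i j) => [lt_ij|lt_ji|/ord_inj ->] //=.
  rewrite -leqNgt ltn_neqAle; case: eqP => //= /ord_inj /perm_inj eq_ij.
  by move: lt_ij; rewrite eq_ij ltnn.
by rewrite ltnn.
Qed.

(** The inversions of w tell, for every i and j, whether w i < w j; so two
    permutations with the same inversions differ by an increasing one. *)
Lemma inversions_inj n : injective (@inversions n).
Proof.
move=> v w eq_inv; apply/eqP; rewrite eq_sym eq_mulVg1; apply/eqP.
apply: increasing_perm1 => i j lt_ij; rewrite !permM ltn_perm_inversions.
by rewrite eq_inv -ltn_perm_inversions !permKV.
Qed.

Lemma inversions1 n : inversions (1 : 'S_n) = set0.
Proof. by apply/setP => p; rewrite !inE !perm1; lia. Qed.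

(** The transposition s of i and j = i + 1 preserves the order of every pair
    other than (i, j); so (a, b) |-> (s a, s b) matches the inversions of s * w
    other than (i, j) with those of w, while (i, j) itself is an inversion of
    exactly one of the two.  The two added terms stand for this difference of
    one, whose sign depends on w. *)
Lemma card_inversions_tperm n (w : 'S_n) (i j : 'I_n) : j = i.+1 :> nat ->
  #|inversions (tperm i j * w)| + (w j < w i)
    = #|inversions w| + (w i < w j).
Proof.
move=> eq_j; set s := tperm i j.
pose f (p : 'I_n * 'I_n) := (s p.1, s p.2).
have fK : involutive f by case=> a b; rewrite /f /= !tpermK.
have lt_s (a b : 'I_n) : (a, b) != (i, j) -> (a < b) -> s a < s b.
  by rewrite xpair_eqE !permE /= -!val_eqE /=; do 4? case: ifP; lia.
have lt_ij : i < j by rewrite eq_j.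
have f_im : f @: (inversions w :\ (i, j)) = inversions (s * w)%g :\ (i, j).
  apply/setP => p; rewrite -[p]fK mem_imset; last exact: inv_inj.
  case: (f p) => a b; rewrite /f !inE /= !permM !tpermK.
  apply/idP/idP => /andP[ne_ab /andP[lt_ab ->]]; rewrite andbT.
    rewrite lt_s // andbT; apply: contraTneq lt_ab => -[ea eb].
    by rewrite -(tpermK i j a) -(tpermK i j b) -/s ea eb tpermL tpermR; lia.
  rewrite -(tpermK i j a) -(tpermK i j b) lt_s // andbT.
  apply: contraTneq lt_ab => -[ea eb].
  by move: ea eb; rewrite !tpermK => -> ->; rewrite tpermL tpermR; lia.
have := card_imset (mem (inversions w :\ (i, j))) (inv_inj fK).
rewrite f_im (cardsD1 (i, j) (inversions w)).
rewrite (cardsD1 (i, j) (inversions (s * w))) => ->.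
by rewrite !inE /= !permM tpermL tpermR lt_ij /= addnC addnA addnAC.
Qed.

(** * Coxeter length *)

Lemma G_fix n k (w : 'S_n) : w \in G n k -> forall i : 'I_n, k <= i -> w i = i.
Proof.
rewrite inE => w_on i le_ki; apply: (out_perm w_on).
by rewrite inE -leqNgt.
Qed.

Lemma G_ltn n k (w : 'S_n) : w \in G n k ->
  forall i : 'I_n, (w i < k) = (i < k).
Proof.
by rewrite inE => w_on i; have := perm_closed i w_on; rewrite !inE.
Qed.

(** If k <= j, then w j = j, while w i < j: either i < k and then w i < k, or i
    is fixed by w. *)
Lemma inversion_G n k (w : 'S_n) (i j : 'I_n) :
  w \in G n k -> i < j -> w j < w i -> j < k.
Proof.
move=> wG lt_ij; apply: contraLR; rewrite -!leqNgt => le_kj.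
rewrite (G_fix wG le_kj).
case: (ltnP i k) => [lt_ik|/(G_fix wG)->]; last exact: ltnW.
by apply: ltnW; apply: leq_trans le_kj; rewrite (G_ltn wG).
Qed.

Lemma J_sub_G n k : J n k \subset G n k.
Proof.
apply/subsetP => s /imset2P[i j _]; rewrite inE => /andP[/eqP eq_j lt_jk] ->.
rewrite inE; apply/subsetP => a; rewrite !inE.
by case: tpermP => [->|->|]; rewrite ?eqxx //; lia.
Qed.

Lemma W_sub_G n k : W n k \subset G n k.
Proof. by rewrite gen_subG J_sub_G. Qed.

(** If w i < w (i + 1) for all i, then w is increasing. *)
Lemma adjacent_descent n (w : 'S_n) : w != 1%g ->
  exists i j : 'I_n, j = i.+1 :> nat /\ w j < w i.
Proof.
move=> w_ne1.
have [/existsP[i /existsP[j /andP[/eqP ? ?]]]|no_descent] :=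
  boolP [exists i : 'I_n, exists j : 'I_n, (j == i.+1 :> nat) && (w j < w i)].
  by exists i, j.
case/eqP: w_ne1; apply: increasing_perm1 => i j.
have [d] := ubnP (j : nat); elim: d => // d IHd in j * => lt_jd lt_ij.
have lt_j'n : j.-1 < n by have := ltn_ord j; lia.
pose j' := Ordinal lt_j'n.
have lt_j'j : w j' < w j.
  rewrite ltn_neqAle; apply/andP; split.
    by apply/negP => /eqP/ord_inj/perm_inj/(congr1 val) /=; lia.
  move: no_descent; rewrite negb_exists => /forallP/(_ j').
  rewrite negb_exists => /forallP/(_ j).
  by rewrite negb_and -leqNgt /= prednK ?eqxx //; lia.
have [eq_ij'|ne_ij'] := eqVneq i j'; first by rewrite eq_ij'.
apply: leq_trans lt_j'j; apply: ltnW; apply: IHd => /=; first lia.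
by move: ne_ij'; rewrite -val_eqE /=; lia.
Qed.

(** Bubble sort.  For w supported on the first k letters the adjacent descents
    lie among these letters, so that the transpositions used belong to J_k. *)
Lemma inversions_word n k (w : 'S_n) : w \in G n k ->
  exists t : #|inversions w|.-tuple 'S_n,
    all (mem (J n k)) t && ((\prod_(s <- t) s)%g == w).
Proof.
move: {2}#|_| (erefl #|inversions w|) => m; elim: m => [|m IHm] in w *.
  move=> inv0 _; rewrite inv0; exists [tuple]; rewrite /= big_nil eq_sym.
  by apply/eqP/inversions_inj; rewrite inversions1; apply: cards0_eq.
move=> invS wG.
have w_ne1 : w != 1%g.
  by apply/eqP => w1; move: invS; rewrite w1 inversions1 cards0.
have [i [j [eq_j desc]]] := adjacent_descent w_ne1.
have lt_jk : j < k by apply: (inversion_G wG _ desc); rewrite eq_j.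
have sJ : tperm i j \in J n k.
  by apply/imset2P; exists i j => //; rewrite inE eq_j eqxx /= -eq_j.
have eq_m : #|inversions (tperm i j * w)| = m.
  by have := card_inversions_tperm w eq_j; rewrite invS desc; lia.
have [] := IHm (tperm i j * w)%g eq_m.
  by rewrite groupM // (subsetP (J_sub_G n k)).
rewrite eq_m invS => t /andP[t_J /eqP t_prod].
exists [tuple of tperm i j :: t]; rewrite /= sJ t_J /= big_cons t_prod.
by rewrite mulgA tperm2 mul1g.
Qed.

Lemma G_full n : G n n = setT.
Proof.
by apply/setP => w; rewrite !inE; apply/subsetP => a _; rewrite inE.
Qed.

Lemma has_word_inversions n (w : 'S_n) : has_word w #|inversions w|.
Proof. by apply/existsP/inversions_word; rewrite G_full inE. Qed.

Lemma leq_inversions_word n (w : 'S_n) m : has_word w m -> #|inversions w| <= m.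
Proof.
case/existsP => t /andP[t_refl /eqP <-]; rewrite -[leqRHS](size_tuple t).
elim: (tval t) t_refl => [|s ts IHts] /=.
  by rewrite big_nil inversions1 cards0.
case/andP => /imset2P[i j _ + ->] /IHts.
rewrite inE big_cons => /andP[/eqP eq_j _].
move=> le_ts; set v := (\prod_(s <- ts) s)%g in le_ts *.
have := leq_addr (v j < v i) #|inversions (tperm i j * v)|.
rewrite card_inversions_tperm // => /leq_trans; apply.
by rewrite -[(size ts).+1]addn1 leq_add // leq_b1.
Qed.

Lemma coxeter_lengthE n (w : 'S_n) : coxeter_length w = #|inversions w|.
Proof.
rewrite /coxeter_length; case: ex_minnP => m w_m min_m; apply/eqP.
by rewrite eqn_leq leq_inversions_word // min_m // has_word_inversions.
Qed.

(** * The longest element of a parabolic subgroup *)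

Lemma inversions_sub n k (w : 'S_n) : w \in G n k ->
  inversions w \subset first_pairs n k.
Proof.
move=> wG; apply/subsetP => -[i j]; rewrite !inE /= => /andP[lt_ij desc].
by rewrite lt_ij (inversion_G wG lt_ij desc).
Qed.

Lemma card_first_pairs n k : k <= n -> #|first_pairs n k| = 'C(k, 2).
Proof.
elim: k => [|k IHk] lt_kn.
  by apply: eq_card0 => p; rewrite !inE ltn0 andbF.
pose jk := Ordinal lt_kn.
have -> : first_pairs n k.+1
    = first_pairs n k :|: [set (widen_ord (ltnW lt_kn) i, jk) | i : 'I_k].
  apply/setP => -[a b]; rewrite !inE /=; apply/idP/orP.
    case/andP=> lt_ab; rewrite ltnS leq_eqVlt => /orP[/eqP eq_b|->]; last first.
      by left; rewrite lt_ab.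
    right; rewrite eq_b in lt_ab; apply/imsetP; exists (Ordinal lt_ab) => //.
    by congr (_, _); apply: ord_inj.
  case=> [|/imsetP[i _ [-> ->]]] /=; first lia.
  by rewrite ltn_ord ltnSn.
rewrite cardsU IHk ?(ltnW lt_kn) // card_imset; last first.
  by move=> i i' [] eq_i; apply: ord_inj.
rewrite card_ord binS bin1 [X in _ - X](_ : _ = 0) ?subn0 //.
apply: eq_card0 => p; rewrite !inE; apply/negP => /andP[/andP[_ lt_pk]].
by case/imsetP => i _ eq_p; move: lt_pk; rewrite eq_p /= ltnn.
Qed.

Lemma leq_card_inversions n k (w : 'S_n) : k <= n -> w \in G n k ->
  #|inversions w| <= 'C(k, 2).
Proof.
move=> le_kn wG; rewrite -(card_first_pairs le_kn).
by rewrite subset_leq_card // inversions_sub.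
Qed.

Lemma reversalE n k (i : 'I_n) : k <= n ->
  reversal n k i = (if i < k then k.-1 - i else i) :> nat.
Proof.
move=> le_kn; rewrite permE /reversal_fun; case: ifP => // lt_ik.
(* As k <= n, [insubd] does not take its default value. *)
by rewrite val_insubd; have := ltn_ord i; case: ifP; lia.
Qed.

Lemma reversal_G n k : k <= n -> reversal n k \in G n k.
Proof.
move=> le_kn; rewrite inE; apply/subsetP => i; rewrite !inE.
apply: contraR => ge_ik.
by apply/eqP/ord_inj; rewrite reversalE // (negPf ge_ik).
Qed.

Lemma inversions_reversal n k : k <= n ->
  inversions (reversal n k) = first_pairs n k.
Proof.
move=> le_kn; apply/eqP; rewrite eqEsubset inversions_sub ?reversal_G //=.
apply/subsetP => -[i j]; rewrite !inE /= => /andP[lt_ij lt_jk].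
rewrite lt_ij !reversalE // lt_jk (ltn_trans lt_ij lt_jk); lia.
Qed.

(** Equality forces all pairs of the first k letters to be inversions, and the
    inversions determine the permutation. *)
Lemma max_length_reversal n k (w : 'S_n) : k <= n -> w \in G n k ->
  'C(k, 2) <= coxeter_length w -> w = reversal n k.
Proof.
move=> le_kn wG; rewrite coxeter_lengthE -(card_first_pairs le_kn) => le_inv.
apply: inversions_inj; rewrite inversions_reversal //; apply/eqP.
by rewrite eqEcard inversions_sub.
Qed.

Lemma coxeter_length_reversal n k : k <= n ->
  coxeter_length (reversal n k) = 'C(k, 2).
Proof.
move=> le_kn.
by rewrite coxeter_lengthE inversions_reversal // card_first_pairs.
Qed.

Lemma G_sub_W n k : G n k \subset W n k.
Proof.
apply/subsetP => w /inversions_word[t /andP[/allP t_J /eqP <-]].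
by rewrite big_seq group_prod // => s /t_J; exact: mem_gen.
Qed.

Lemma w0E n k : k <= n -> w0 n k = reversal n k.
Proof.
move=> le_kn; rewrite /w0; case: arg_maxnP => [|w wW w_max].
  exact: group1.
apply: max_length_reversal => //; first exact: (subsetP (W_sub_G n k)).
rewrite -(coxeter_length_reversal le_kn); apply: w_max.
exact: (subsetP (G_sub_W n k)) (reversal_G le_kn).
Qed.

(** * Zaks' tower *)

Lemma with_g1_reversal n k : k <= n -> with_g1 (reversal n) k = reversal n k.
Proof.
move=> le_kn; rewrite /with_g1; case: ifP => // le_k1; apply/permP => i.
by apply: ord_inj; rewrite perm1 reversalE //; case: ifP; lia.
Qed.

Lemma step_reversalE n k (i : 'I_n) : 2 <= k <= n ->
  step (reversal n) k i
    = (if i < k then if i == 0 :> nat then k.-1 else i.-1 else i) :> nat.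
Proof.
case/andP=> lt1k le_kn; have le_k'n : k.-1 <= n by lia.
rewrite /step !with_g1_reversal // permM; set j := RHS.
have lt_jn : j < n by rewrite /j; have := ltn_ord i; do 2?case: ifP; lia.
suff -> : reversal n k i = reversal n k.-1 (Ordinal lt_jn) by rewrite permK.
by apply: ord_inj; rewrite !reversalE //= /j; do 4?case: ifP; lia.
Qed.

(** The m-th iterate of the step sends k - 1 to k - 1 - m for m < k, so that the
    orbit of k - 1 contains all the first k letters. *)
Lemma step_reversal_cycle n k : 2 <= k <= n ->
  is_full_cycle k (step (reversal n) k).
Proof.
move=> k_bnd; have [lt1k le_kn] := andP k_bnd; set u := step _ k.
have uG : u \in G n k.
  rewrite inE; apply/subsetP => i; rewrite !inE; apply: contraR => ge_ik.
  by apply/eqP/ord_inj; rewrite step_reversalE // (negPf ge_ik).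
split=> //.
have lt_k'n : k.-1 < n by lia.
pose top := Ordinal lt_k'n.
have u_iter m : m < k -> (u ^+ m)%g top = k.-1 - m :> nat.
  elim: m => [|m IHm] lt_mk; first by rewrite expg0 perm1 subn0.
  by rewrite expgSr permM step_reversalE // IHm ?(ltnW lt_mk) //;
     do 2?case: ifP; lia.
suff -> : first_letters n k = porbit u top by apply: imset_f.
apply/setP => i; rewrite inE; apply/idP/porbitP => [lt_ik|[m ->]].
  by exists (k.-1 - i); apply: ord_inj; rewrite u_iter; lia.
by rewrite (G_ltn (groupX m uG)) /=; lia.
Qed.

Lemma reversal_notin_G n k : 2 <= k <= n -> reversal n k \notin G n k.-1.
Proof.
case/andP=> lt1k le_kn; have lt_k'n : k.-1 < n by lia.
apply/negP => /G_fix/(_ (Ordinal lt_k'n) (leqnn _))/(congr1 val).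
by rewrite /= reversalE //=; case: ifP; lia.
Qed.

Lemma is_tower_reversal n : is_tower (reversal n).
Proof.
move=> k k_bnd; split; [|exact: reversal_notin_G|exact: step_reversal_cycle].
by apply: reversal_G; case/andP: k_bnd.
Qed.

Lemma eq_is_tower n (g h : nat -> 'S_n) :
  (forall k, 2 <= k <= n -> g k = h k) -> is_tower g -> is_tower h.
Proof.
move=> eq_gh g_tower k k_bnd.
have eq1 m : m <= n -> with_g1 g m = with_g1 h m.
  by move=> le_mn; rewrite /with_g1; case: ltnP => // lt1m; rewrite eq_gh ?lt1m.
have := g_tower k k_bnd; rewrite /step !eq1 ?eq_gh //; lia.
Qed.

(** * The total length *)

(** Hockey-stick identity. *)
Lemma sum_bin2 n : 2 <= n -> \sum_(2 <= k < n.+1) 'C(k, 2) = 'C(n.+1, 3).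
Proof.
elim: n => // n IHn; rewrite ltnS leq_eqVlt => /orP[/eqP <-|lt1n].
  by rewrite big_nat1.
by rewrite [RHS]binS big_nat_recr ?IHn //; lia.
Qed.

Lemma total_length_eq n (g : nat -> 'S_n) : 2 <= n ->
  (forall k, 2 <= k <= n -> coxeter_length (g k) = 'C(k, 2)) ->
  total_length g = 'C(n.+1, 3).
Proof. by move=> hn eq_len; rewrite -sum_bin2 //; apply: eq_big_nat. Qed.

Theorem theorem7p1 (n : nat) (hn : 2 <= n) :
  (forall g : nat -> 'S_n, is_tower g ->
     total_length g <= 'C(n.+1, 3) /\
     (total_length g = 'C(n.+1, 3) ->
      forall k : nat, 2 <= k <= n -> g k = w0 n k)) /\
  is_tower (w0 n) /\
  (forall k : nat, 2 <= k <= n -> w0 n k = reversal n k) /\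
  total_length (w0 n) = 'C(n.+1, 3).
Proof.
have w0_rev k : 2 <= k <= n -> w0 n k = reversal n k.
  by case/andP=> _; exact: w0E.
split; [|split; [|split=> //]]; last first.
- apply: total_length_eq => // k k_bnd; rewrite w0_rev //.
  by apply: coxeter_length_reversal; case/andP: k_bnd.
- by apply: eq_is_tower (@is_tower_reversal n) => k /w0_rev.
move=> g g_tower.
have gG k : 2 <= k <= n -> g k \in G n k by case/g_tower.
have le_len k : 2 <= k <= n -> coxeter_length (g k) <= 'C(k, 2).
  move=> k_bnd; rewrite coxeter_lengthE leq_card_inversions ?gG //.
  by case/andP: k_bnd.
have le_total k : (2 <= k < n.+1) && true -> coxeter_length (g k) <= 'C(k, 2).
  by rewrite andbT => /le_len.
split=> [|eq_total k k_bnd].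
  rewrite -sum_bin2 // /total_length big_nat_cond [leqRHS]big_nat_cond.
  exact: leq_sum.
(* The defects from the termwise bounds are naturals with sum 0, so all are 0. *)
have : \sum_(2 <= k < n.+1) ('C(k, 2) - coxeter_length (g k)) = 0.
  rewrite big_nat_cond sumnB // -!big_nat_cond sum_bin2 //.
  by rewrite -/(total_length g) eq_total subnn.
move/eqP; rewrite sum_nat_seq_eq0 => /allP/(_ k).
rewrite mem_index_iota subn_eq0 => /(_ k_bnd) /= ge_len; rewrite w0_rev //.
by apply: max_length_reversal => //; [case/andP: k_bnd|exact: gG].
Qed.
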